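(* Let $k\ge 1$, $n\ge 2$, $\mathbf C=(c_0,\dots,c_k)\in\{0,1\}^{k+1}$, and $\gamma$ Euler's constant. Put $\lambda=c_0(n-1)+c_1k(\log(n-1)+\gamma)+\frac{\pi^2}{6}\sum_{\beta=2}^kc_\beta\binom{k}{\beta}$ and $\lambda'=c'_0(n-1)+c'_1k(\log(n-1)+\gamma)+\frac{\pi^2}{6}\sum_{\beta=2}^kc'_\beta\binom{k}{\beta}$. Then: (i) for $0\le m\le n$, $O_{\mathbf C}(n,m)\le O_{\mathbf C'\max}(n,n-m)$; (ii) $\dfrac{\sum_{m=0}^nO_{\mathbf C\max}(n,m)}{\sum_{m=0}^nO_{\mathbf C}(n,m)}\le\exp(\lambda)$; (iii) $\dfrac{\sum_{m=0}^nO_{\mathbf C'\max}(n,m)}{\sum_{m=0}^nO_{\mathbf C}(n,m)}\le\exp(\lambda')$; (iv) for $k=1$, $\mathbf C=(0,1)$, with $s_u(n,m)$ the unsigned Stirling numbers of the first kind and $s_{u\max}(n,m)=\frac{(n-1)!}{(m-1)!}\left(\sum_{i=1}^{n-1}\frac1i\right)^{m-1}$ for $1\le m\le n$ (and $0$ for $m=0$), $$\frac{\sum_{m=0}^ns_{u\max}(n,m)}{\sum_{m=0}^ns_u(n,m)}\le\frac{n-1}{n}\exp\Big(\sum_{j=2}^n\frac1{j-1}-\log(n-1)\Big)\le\exp(\gamma)\le 1.7811.$$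
   Context: Fix integers $k\ge 1$, $n\ge 2$ and $\mathbf C=(c_0,\dots,c_k)\in\{0,1\}^{k+1}$; put $\mathbf C'=(1,\dots,1)-\mathbf C=(c'_0,\dots,c'_k)$. Consider $k$-tuples $(\pi_1,\dots,\pi_k)$ of permutations of $\{1,\dots,n\}$. A position $\alpha$ is a record of a permutation $\pi$ if $\pi(\alpha)<\pi(\alpha')$ for every $\alpha'<\alpha$ (position $1$ is always a record). For a tuple, let $l_\alpha$ be the number of $\beta\in\{1,\dots,k\}$ for which $\alpha$ is a record of $\pi_\beta$. The $\mathbf C$ sequential optimization set is $S=\{\alpha:c_{l_\alpha}=1\}$, with weight $|S|$; $O_{\mathbf C}(n,m)$ is the number of $k$-tuples of weight $m$ (for integer $m$), and $O_{\mathbf C'}$ is the same with $\mathbf C'$. For $j\ge2$ and $X\in\mathbb R^{k+1}$, $F_j(X)=\sum_{\beta=0}^k\binom{k}{\beta}\frac{x_\beta}{(j-1)^\beta}$. Let $\mathbf H_n\mathbf X^T=\sum_{\beta=0}^k x_\beta\binom{k}{\beta}\sum_{j=1}^{n-1}j^{-\beta}$. For $1\le m\le n$, $O_{\mathbf C\max}(n,m+c_k-1)=\frac{(n-1)!^k}{(m-1)!}(\mathbf H_n\mathbf C^T)^{m-1}\prod_{i=1}^{n-m}F_{i+1}(\mathbf C')$ and $O_{\mathbf C'\max}(n,m+c'_k-1)=\frac{(n-1)!^k}{(m-1)!}(\mathbf H_n\mathbf C'^T)^{m-1}\prod_{i=1}^{n-m}F_{i+1}(\mathbf C)$; at integer arguments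 outside these ranges $O_{\mathbf C\max}$ and $O_{\mathbf C'\max}$ are taken to be $0$. Empty products equal $1$; $\log$ is the natural logarithm. *)

(* Defs.v *)
From HB Require Import structures.
From mathcomp Require Import all_boot all_order all_algebra all_fingroup.
From mathcomp Require Import all_classical all_reals all_analysis.
Set Implicit Arguments. Unset Strict Implicit. Unset Printing Implicit Defensive.
Import Order.TTheory GRing.Theory Num.Theory.
Local Open Scope ring_scope.

(* Positions {1..n} are encoded as 'I_n = {0..n-1}; k-tuples of permutations
   of {1..n} as finite functions 'I_k -> {perm 'I_n}.
   C = (c_0,...,c_k) is a function 'I_k.+1 -> bool. *)

Definition ktuple (k n : nat) := {ffun 'I_k -> {perm 'I_n}}.

Definition is_record (n : nat) (p : {perm 'I_n}) (a : 'I_n) : bool :=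
  [forall a' : 'I_n, (a' < a)%N ==> (p a < p a')%N].

Definition lcount (k n : nat) (t : ktuple k n) (a : 'I_n) : nat :=
  #|[set b : 'I_k | is_record (t b) a]|.

(* the C sequential optimization set S = {alpha : c_{l_alpha} = 1}
   (l_alpha <= k, so inord is the identity on its value) *)
Definition opt_set (k n : nat) (C : 'I_k.+1 -> bool) (t : ktuple k n)
  : {set 'I_n} := [set a : 'I_n | C (inord (lcount t a))].

Definition weight (k n : nat) (C : 'I_k.+1 -> bool) (t : ktuple k n) : nat :=
  #|opt_set C t|.

Definition OC (k n : nat) (C : 'I_k.+1 -> bool) (m : nat) : nat :=
  #|[set t : ktuple k n | weight C t == m]|.

Definition compl (k : nat) (C : 'I_k.+1 -> bool) : 'I_k.+1 -> bool :=
  fun i => ~~ C i.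

Definition vecR (R : realType) (k : nat) (C : 'I_k.+1 -> bool) : 'I_k.+1 -> R :=
  fun i => (C i : nat)%:R.

Definition HnX (R : realType) (k n : nat) (X : 'I_k.+1 -> R) : R :=
  \sum_(b < k.+1) X b * 'C(k, b)%:R * \sum_(1 <= j < n) (j%:R ^- b).

Definition Fj (R : realType) (k j : nat) (X : 'I_k.+1 -> R) : R :=
  \sum_(b < k.+1) 'C(k, b)%:R * X b / ((j.-1)%:R ^+ b).

(* O_{C max}(n, a): for a = m + c_k - 1 with 1 <= m <= n, i.e. m = a + 1 - c_k,
   the formula; 0 otherwise.  (Only nonnegative arguments a are ever used;
   negative integer arguments give 0 by convention.)  O_{C' max} is
   OCmax (compl C). *)
Definition OCmax (R : realType) (k n : nat) (C : 'I_k.+1 -> bool) (a : nat) : R :=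
  let m := (a.+1 - C ord_max)%N in
  if (1 <= m <= n)%N then
    ((n.-1)`!)%:R ^+ k / ((m.-1)`!)%:R * (HnX n (vecR R C)) ^+ m.-1
      * \prod_(1 <= i < (n - m).+1) Fj i.+1 (vecR R (compl C))
  else 0.

Definition euler_gamma (R : realType) : R :=
  limn (fun N : nat => \sum_(1 <= j < N.+1) (j%:R : R)^-1 - ln (N%:R : R)).

Fixpoint stirling1u (n m : nat) : nat :=
  match n, m with
  | 0, 0 => 1
  | 0, _.+1 => 0
  | _.+1, 0 => 0
  | n'.+1, m'.+1 => n' * stirling1u n' m'.+1 + stirling1u n' m'
  end.

Definition sumax (R : realType) (n m : nat) : R :=
  if (1 <= m <= n)%N then
    ((n.-1)`!)%:R / ((m.-1)`!)%:R * (\sum_(1 <= i < n) (i%:R : R)^-1) ^+ m.-1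
  else 0.

Definition lambdaC (R : realType) (k n : nat) (C : 'I_k.+1 -> bool) : R :=
  vecR R C (inord 0) * (n.-1)%:R
  + vecR R C (inord 1) * k%:R * (ln ((n.-1)%:R : R) + euler_gamma R)
  + pi ^+ 2 / 6%:R * \sum_(2 <= b < k.+1) vecR R C (inord b) * 'C(k, b)%:R.

(* Main.v *)
Require Import Defs.
From HB Require Import structures.
From mathcomp Require Import all_boot all_order all_algebra all_fingroup.
From mathcomp Require Import all_classical all_reals all_analysis.
From mathcomp Require Import ring lra zify.
Import Order.TTheory GRing.Theory Num.Theory.
Import numFieldNormedType.Exports.
Local Open Scope ring_scope.
Set Implicit Arguments.
Unset Strict Implicit.
Unset Printing Implicit Defensive.

(** Deleting the last position of each permutation of a tuple shows that the
    numbers [l_alpha] are built one position at a time, whence the recursion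
    O(n+1, m) = n^k (F_(n+1)(C') O(n, m) + F_(n+1)(C) O(n, m-1)).
    Since F_j decreases in j, the closed form O_max satisfies the corresponding
    recursive inequality because H^q + q F H^(q-1) <= (H + F)^q; part (i) is this
    bound for C', as complementing C turns weight m into weight n - m.

    For (ii) and (iii), H_n C^T itself can exceed lambda, because the harmonic
    number h_N exceeds log N + gamma.  But h_N <= (1 + 1/N)(log N + gamma) with
    N = n - 1, by gamma >= max (1/2, h_N - log N - 1/(2N)), hence
    H_n C^T <= (n/(n-1)) lambda; and the product of the first n-1-q values of F
    is at most (n-q)^k.  As (n/(n-1))^q (n-q) <= n, the q-th summand of the
    numerator is at most n!^k lambda^q / q!, and these sum to at most
    n!^k exp lambda. *)

(** * Record positions and the recursion for [OC] *)

(** Being a record depends only on the relative order of the values up to [a], and inserting a last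
    value [j] relabels the old values by the monotone map [lift j]. *)
Lemma is_record_lift_perm (n : nat) (j : 'I_n.+1) (s : {perm 'I_n}) (a : 'I_n) :
  is_record (lift_perm ord_max j s) (lift ord_max a) = is_record s a.
Proof.
apply/forallP/forallP => H a'; apply/implyP => lt_a'a.
  move/implyP: (H (lift ord_max a')); rewrite !lift_max !lift_perm_lift.
  by move=> /(_ lt_a'a); rewrite /= /bump; lia.
case: (unliftP ord_max a') lt_a'a => [b ->|-> /=]; last first.
  by rewrite /bump; have := ltn_ord a; lia.
rewrite !lift_max => lt_ba; move/implyP: (H b) => /(_ lt_ba).
by rewrite !lift_perm_lift /= /bump; lia.
Qed.

Lemma is_record_ord_max (n : nat) (j : 'I_n.+1) (s : {perm 'I_n}) :
  is_record (lift_perm ord_max j s) ord_max = (j == ord0).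
Proof.
apply/forallP/eqP => [H|-> a'].
  apply/eqP; case: (eqVneq j ord0) => // nj.
  (* Otherwise the position [a] holding the least value comes earlier and refutes the record. *)
  set p := lift_perm ord_max j s in H *; pose a := (p^-1)%g ord0.
  have pa : p a = ord0 by rewrite /a permKV.
  have a_max : a != ord_max.
    by apply: contra nj => /eqP ea; rewrite -pa ea /p lift_perm_id.
  have lt_a : (a < @ord_max n)%N.
    by rewrite ltn_neqAle -ltnS ltn_ord andbT; apply: contra a_max => /eqP/val_inj->.
  by move/implyP: (H a) => /(_ lt_a); rewrite pa ltn0.
apply/implyP; case: (unliftP ord_max a') => [b ->|->]; last by rewrite ltnn.
by rewrite lift_perm_id lift_perm_lift.
Qed.

(* Deleting the last position of each permutation and standardizing inverts
   [extend_tuple]. *)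
Definition extend_tuple (k n : nat) (ft : {ffun 'I_k -> 'I_n.+1} * ktuple k n) :
  ktuple k n.+1 := [ffun b => lift_perm ord_max (ft.1 b) (ft.2 b)].

Definition zero_set (k n : nat) (f : {ffun 'I_k -> 'I_n.+1}) : {set 'I_k} :=
  [set b | f b == ord0].

Lemma card_ktuple (k n : nat) : #|{: ktuple k n}| = (n`! ^ k)%N.
Proof. by rewrite card_ffun card_ord (card_Sn n). Qed.

(** Injectivity suffices, as both sides have (n+1)!^k elements; the value at the last position
    recovers [f], after which [lift] can be cancelled. *)
Lemma extend_tuple_bij (k n : nat) : bijective (@extend_tuple k n).
Proof.
apply: inj_card_bij.
  move=> [f t] [g u] /ffunP /= E; congr pair; apply/ffunP => b.
    by have := E b; rewrite !ffunE => /permP/(_ ord_max); rewrite !lift_perm_id.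
  apply/permP => a; have := E b; rewrite !ffunE /= => /permP E'.
  have := E' ord_max; rewrite !lift_perm_id => fg.
  by have := E' (lift ord_max a); rewrite !lift_perm_lift fg => /lift_inj.
by rewrite card_prod !card_ktuple card_ffun !card_ord factS expnMn.
Qed.

Lemma lcount_extend_lift (k n : nat) f (t : ktuple k n) (a : 'I_n) :
  lcount (extend_tuple (f, t)) (lift ord_max a) = lcount t a.
Proof. by apply: eq_card => b; rewrite !inE ffunE is_record_lift_perm. Qed.

Lemma lcount_extend_max (k n : nat) f (t : ktuple k n) :
  lcount (extend_tuple (f, t)) ord_max = #|zero_set f|.
Proof. by apply: eq_card => b; rewrite !inE ffunE is_record_ord_max. Qed.

Lemma weight_sum (k n : nat) (C : 'I_k.+1 -> bool) (t : ktuple k n) :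
  weight C t = (\sum_(a < n) C (inord (lcount t a)))%N.
Proof.
rewrite /weight -sum1_card big_mkcond /=; apply: eq_bigr => a _.
by rewrite inE; case: (C _).
Qed.

Lemma weight_extend (k n : nat) (C : 'I_k.+1 -> bool) f (t : ktuple k n) :
  weight C (extend_tuple (f, t)) = (weight C t + C (inord #|zero_set f|))%N.
Proof.
rewrite !weight_sum big_ord_recr /= lcount_extend_max; congr addn.
apply: eq_bigr => a _; congr (nat_of_bool (C (inord _))).
rewrite -(lcount_extend_lift f); congr lcount; apply: val_inj.
by rewrite /= /bump leqNgt ltn_ord.
Qed.

(** Counts the choices of last values that put the new position into the optimization set; for n > 0
    this is n^k F_(n+1)(C). *)
Definition last_count (k n : nat) (C : 'I_k.+1 -> bool) : nat :=
  #|[set f : {ffun 'I_k -> 'I_n.+1} | C (inord #|zero_set f|)]|.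

(** Split the extended tuples by whether the new last position joins the set: if not, the old weight
    is already m; if so, it is m - 1. *)
Lemma OC_recr (k n : nat) (C : 'I_k.+1 -> bool) (m : nat) :
  OC n.+1 C m = (last_count n (compl C) * OC n C m
    + last_count n C * (if m is m'.+1 then OC n C m' else 0))%N.
Proof.
have [e ke ek] := extend_tuple_bij k n.
rewrite /OC -sum1_card (reindex (@extend_tuple k n)) /=; last first.
  by exists e => x _.
rewrite (eq_bigl (fun p => true &&
  (weight C p.2 + C (inord #|zero_set p.1|) == m))%N); last first.
  by move=> [f t]; rewrite inE weight_extend.
rewrite -(pair_big_dep xpredT (fun (f : {ffun 'I_k -> 'I_n.+1}) (t : ktuple k n) =>
  (weight C t + C (inord #|zero_set f|) == m)%N) (fun _ _ => 1%N)) /=.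
rewrite (bigID (fun f : {ffun 'I_k -> 'I_n.+1} => C (inord #|zero_set f|))) /= addnC.
congr addn.
  rewrite (eq_bigr (fun=> #|[set t : ktuple k n | weight C t == m]|)); last first.
    move=> f /negPf cf; rewrite sum1_card -[in RHS]cardsE; apply: eq_card => t.
    by rewrite !inE /in_mem /= cf addn0.
  rewrite sum_nat_const; congr muln.
  by apply: eq_card => f; rewrite !inE.
rewrite (eq_bigr (fun=> if m is m'.+1
  then #|[set t : ktuple k n | weight C t == m']| else 0%N)).
  rewrite sum_nat_const; congr muln.
  by apply: eq_card => f; rewrite !inE.
move=> f cf; rewrite sum1_card; case: m => [|m].
  by apply: eq_card0 => t; rewrite /in_mem /= cf addn1.
by rewrite -[in RHS]cardsE; apply: eq_card => t; rewrite !inE /in_mem /= cf addn1.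
Qed.

Lemma card_zero_set (k n : nat) (B : {set 'I_k}) :
  #|[set f : {ffun 'I_k -> 'I_n.+1} | zero_set f == B]| = (n ^ (k - #|B|))%N.
Proof.
pose F (b : 'I_k) : pred 'I_n.+1 := if b \in B then pred1 ord0 else predC1 ord0.
transitivity #|family F|.
  apply: eq_card => f; rewrite !inE; apply/eqP/familyP => [fB b|fB].
    by rewrite /F -fB inE; case: ifP => fb; rewrite inE /= fb.
  apply/setP => b; have := fB b; rewrite /F inE.
  by case: ifP => _; rewrite inE /= => fb; [exact: fb | exact: negPf fb].
rewrite card_family foldrE big_image /=.
rewrite (bigID (mem B)) /= big1 ?mul1n; last first.
  by move=> b bB; rewrite /F bB card1.
rewrite (eq_bigr (fun=> n)); last first.
  by move=> b /negPf bB; rewrite /F bB cardC1 card_ord.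
by rewrite prod_nat_const -[k in (k - _)%N]card_ord -(cardC (mem B)) addKn.
Qed.

Lemma last_countE (k n : nat) (C : 'I_k.+1 -> bool) :
  last_count n C = (\sum_(b < k.+1) C b * 'C(k, b) * n ^ (k - b))%N.
Proof.
(* Group the functions by the set B of permutations gaining a record, then these sets by
   cardinality. *)
rewrite /last_count -sum1_card (partition_big (@zero_set k n) predT) //=.
rewrite (partition_big (fun B : {set 'I_k} => inord #|B| : 'I_k.+1) predT) //=.
apply: eq_bigr => b _.
have cB (B : {set 'I_k}) : (inord #|B| == b) = (#|B| == b :> nat).
  by rewrite -val_eqE /= inordK // ltnS -[k in (_ <= k)%N]card_ord max_card.
rewrite (eq_bigr (fun=> C b * n ^ (k - b))%N); last first.
  move=> B /eqP eB; rewrite -eB inordK; last first.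
    by rewrite ltnS -[k in (_ <= k)%N]card_ord max_card.
  case: (boolP (C (inord #|B|))) => cB'; last first.
    rewrite mul0n big1 // => f /andP[+ /eqP fB].
    by rewrite inE fB (negPf cB').
  rewrite mul1n -card_zero_set -sum1_card; apply: eq_bigl => f.
  rewrite !inE; case: (eqVneq (zero_set f) B) => [->|]; last by rewrite andbF.
  by rewrite cB'.
rewrite sum_nat_const mulnA [(_ * C b)%N]mulnC; congr (_ * _ * _)%N.
rewrite -[k in 'C(k, _)]card_ord -(card_draws 'I_k b) -cardsE.
by apply: eq_card => B; rewrite !inE -cB.
Qed.

(** The only case is m = 0 with c_k = 1: the first position is a record of all k permutations, so it
    always belongs to the set. *)
Lemma OC_eq0_small (k n : nat) (C : 'I_k.+1 -> bool) (m : nat) :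
  (0 < n)%N -> (m < C ord_max)%N -> OC n C m = 0%N.
Proof.
case: m => [|m]; last by case: (C _).
case: n => // n _ cmax; elim: n => [|n IH].
  rewrite OC_recr muln0 addn0 last_countE big1 ?mul0n // => b _.
  case: (eqVneq (b : nat) k) => [bk|nbk].
    have -> : b = ord_max by apply: val_inj.
    by rewrite /compl; move: cmax; case: (C _).
  by rewrite exp0n ?muln0 // subn_gt0; have := ltn_ord b; lia.
by rewrite OC_recr IH !muln0.
Qed.

Lemma OC0 (k : nat) (C : 'I_k.+1 -> bool) (m : nat) : OC 0 C m = (m == 0)%N.
Proof.
have w0 (t : ktuple k 0) : weight C t = 0%N by rewrite weight_sum big_ord0.
rewrite /OC; case: m => [|m].
  rewrite (eq_card (B := predT)) ?card_ktuple ?fact0 ?exp1n // => t.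
  by rewrite !inE w0.
by apply: eq_card0 => t; rewrite inE w0.
Qed.

Lemma last_count0 (k : nat) (C : 'I_k.+1 -> bool) :
  last_count 0 C = C ord_max.
Proof.
rewrite last_countE big_ord_recr /= big1 ?add0n; last first.
  by move=> b _; rewrite exp0n ?muln0 // subn_gt0.
by rewrite binn subnn !muln1.
Qed.

Lemma OC1 (k : nat) (C : 'I_k.+1 -> bool) (m : nat) :
  OC 1 C m = (m == C ord_max).
Proof.
rewrite OC_recr !last_count0 /compl; case: (C _); case: m => [|[|m]] //;
  by rewrite !OC0.
Qed.

(** When c_k = 0 the first position never belongs to the set, so the weight is at most n - 1. *)
Lemma OC_eq0_large (k n : nat) (C : 'I_k.+1 -> bool) (m : nat) :
  (0 < n)%N -> (n + C ord_max <= m)%N -> OC n C m = 0%N.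
Proof.
case: n => // n _; elim: n m => [|n IH] [|m] //.
  by move=> Hm; rewrite OC1; case: eqP => // E; move: Hm; rewrite E; lia.
by rewrite addSn ltnS => Hm; rewrite OC_recr !IH ?muln0 //; lia.
Qed.

Lemma OC_compl (k n : nat) (C : 'I_k.+1 -> bool) (m : nat) :
  (m <= n)%N -> OC n C m = OC n (compl C) (n - m).
Proof.
move=> le_mn; apply: eq_card => t; rewrite !inE.
have : (weight C t + weight (compl C) t = n)%N.
  rewrite /weight -[RHS](card_ord n) -(cardsC (opt_set C t)); congr addn.
  by apply: eq_card => a; rewrite !inE.
by move=> E; apply/eqP/eqP; lia.
Qed.

Lemma weight_le (k n : nat) (C : 'I_k.+1 -> bool) (t : ktuple k n) :
  (weight C t <= n)%N.
Proof. by rewrite -[X in (_ <= X)%N]card_ord max_card. Qed.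

Lemma sum_OC (k n : nat) (C : 'I_k.+1 -> bool) :
  (\sum_(0 <= m < n.+1) OC n C m = n`! ^ k)%N.
Proof.
rewrite -card_ktuple big_mkord -sum1_card.
rewrite (partition_big (fun t : ktuple k n => inord (weight C t) : 'I_n.+1) predT) //=.
apply: eq_bigr => m _; rewrite sum1_card /OC; apply: eq_card => t.
by rewrite !inE unfold_in /= inordK // ltnS weight_le.
Qed.

(** * The bound [OCmax] *)

Lemma Fj_ge0 (R : realType) (k j : nat) (C : 'I_k.+1 -> bool) :
  0 <= Fj j (vecR R C).
Proof.
apply: sumr_ge0 => b _; apply: mulr_ge0; last by rewrite invr_ge0 exprn_ge0.
by apply: mulr_ge0.
Qed.

Lemma Fj_antitone (R : realType) (k i j : nat) (C : 'I_k.+1 -> bool) :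
  (0 < i <= j)%N -> Fj j.+1 (vecR R C) <= Fj i.+1 (vecR R C).
Proof.
move=> /andP[i0 ij]; apply: ler_sum => b _; apply: ler_wpM2l.
  by apply: mulr_ge0.
rewrite /= lef_pV2 ?posrE ?exprn_gt0 ?ltr0n //; last exact: leq_trans ij.
by apply: lerXn2r; rewrite ?nnegrE ?ler0n // ler_nat.
Qed.

Lemma HnX_ge0 (R : realType) (k n : nat) (C : 'I_k.+1 -> bool) :
  0 <= HnX n (vecR R C).
Proof.
apply: sumr_ge0 => b _; rewrite !mulr_ge0 //.
by apply: sumr_ge0 => j _; rewrite invr_ge0 exprn_ge0.
Qed.

Lemma HnX1 (R : realType) (k : nat) (X : 'I_k.+1 -> R) : HnX 1 X = 0.
Proof. by rewrite /HnX big1 // => b _; rewrite big_geq // mulr0. Qed.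

Lemma HnXS (R : realType) (k n : nat) (X : 'I_k.+1 -> R) :
  (0 < n)%N -> HnX n.+1 X = HnX n X + Fj n.+1 X.
Proof.
move=> n0; rewrite /HnX /Fj -big_split /=; apply: eq_bigr => b _.
by rewrite big_nat_recr //= mulrDr [X b * _]mulrC.
Qed.

Lemma last_countR (R : realType) (k n : nat) (C : 'I_k.+1 -> bool) :
  (0 < n)%N -> (last_count n C)%:R = n%:R ^+ k * Fj n.+1 (vecR R C).
Proof.
move=> n0; rewrite last_countE natr_sum /Fj mulr_sumr; apply: eq_bigr => b _.
have bk : (b <= k)%N by rewrite -ltnS.
have nz : (n%:R : R) != 0 by rewrite pnatr_eq0 -lt0n.
have -> : n%:R ^+ k = n%:R ^+ (k - b) * n%:R ^+ b :> R by rewrite -exprD subnK.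
by rewrite !natrM natrX /vecR /=; field; rewrite expf_neq0.
Qed.

(** Together C and C' select every term of the binomial expansion of (1 + 1/n)^k. *)
Lemma Fj_add_compl (R : realType) (k n : nat) (C : 'I_k.+1 -> bool) :
  (0 < n)%N ->
  Fj n.+1 (vecR R C) + Fj n.+1 (vecR R (compl C)) = (n.+1%:R / n%:R) ^+ k.
Proof.
move=> n0; have nz : (n%:R : R) != 0 by rewrite pnatr_eq0 -lt0n.
rewrite -natr1 mulrDl divff // mul1r exprDn /Fj -big_split /=.
apply: eq_bigr => b _; rewrite expr1n mul1r exprVn -mulrDl -mulrDr.
by rewrite /vecR /compl; case: (C b); rewrite ?addr0 ?add0r mulr1 /= ?mulr1 mulr_natl.
Qed.

(** The closed form reindexed by q = m - 1, so that its argument is q + c_k and no truncated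
    subtraction of c_k remains. *)
Definition maxterm (R : realType) (k n : nat) (C : 'I_k.+1 -> bool) (q : nat) : R :=
  ((n.-1)`!)%:R ^+ k / (q`!)%:R * HnX n (vecR R C) ^+ q
    * \prod_(1 <= i < (n - q)) Fj i.+1 (vecR R (compl C)).

Lemma OCmaxE (R : realType) (k n : nat) (C : 'I_k.+1 -> bool) (q : nat) :
  (q < n)%N -> OCmax R n C (q + C ord_max) = maxterm R n C q.
Proof.
by move=> qn; rewrite /OCmax -addSn addnK /= qn subnSK.
Qed.

Lemma OCmax_ge0 (R : realType) (k n : nat) (C : 'I_k.+1 -> bool) (a : nat) :
  0 <= OCmax R n C a.
Proof.
rewrite /OCmax; case: ifP => // _; rewrite !mulr_ge0 ?exprn_ge0 ?HnX_ge0 //.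
by apply: prodr_ge0 => i _; exact: Fj_ge0.
Qed.

Lemma first_order_le_exprD (R : realType) (x y : R) (q : nat) :
  0 <= x -> 0 <= y -> x ^+ q.+1 + q.+1%:R * y * x ^+ q <= (x + y) ^+ q.+1.
Proof.
move=> x0 y0; elim: q => [|q IH]; first by rewrite !expr1 expr0; lra.
rewrite exprSr [leRHS]exprSr.
(* Multiplying the induction hypothesis by x + y leaves the surplus (q+1) y^2 x^q. *)
apply: le_trans (ler_wpM2r (addr_ge0 x0 y0) IH).
have := mulr_ge0 (mulr_ge0 y0 y0) (exprn_ge0 q x0).
have := mulr_ge0 (ler0n R q.+1) (mulr_ge0 (mulr_ge0 y0 y0) (exprn_ge0 q x0)).
rewrite -(natr1 q.+1) !exprS => h _; rewrite -subr_ge0.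
by apply: le_trans h _; rewrite le_eqVlt; apply/orP; left; apply/eqP; ring.
Qed.

Lemma OC_le_maxterm (R : realType) (k n : nat) (C : 'I_k.+1 -> bool) (q : nat) :
  (q < n)%N -> (OC n C (q + C ord_max))%:R <= maxterm R n C q.
Proof.
case: n => // n; elim: n q => [|n IH] q; rewrite ltnS.
  rewrite leqn0 => /eqP ->; rewrite OC1 add0n eqxx /maxterm HnX1 expr0 fact0.
  by rewrite expr1n divr1 !mul1r big_geq.
move=> qn; set F := Fj n.+2 (vecR R C); set F' := Fj n.+2 (vecR R (compl C)).
have F0 : 0 <= F := Fj_ge0 _ _ _.
have F'0 : 0 <= F' := Fj_ge0 _ _ _.
have H0 := HnX_ge0 R n.+1 C; set H := HnX n.+1 (vecR R C) in H0 *.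
pose P r := \prod_(1 <= i < r) Fj i.+1 (vecR R (compl C)).
have P0 r : 0 <= P r by apply: prodr_ge0 => i _; exact: Fj_ge0.
have N0 : (0 : R) <= n.+1%:R ^+ k * (n`!)%:R ^+ k by rewrite mulr_ge0 ?exprn_ge0.
(* The newest factor [F'] is the smallest one, so it may stand in for the missing factor F_(r+1). *)
have PF r : (0 < r <= n.+1)%N -> F' * P r <= P r.+1.
  move=> /andP[r0 rn]; rewrite /P big_nat_recr //= mulrC ler_wpM2l //.
    exact: P0.
  by apply: Fj_antitone; rewrite r0.
(* The recursion shifted by c_k; at q = 0 the second term vanishes, by [OC_eq0_small] when c_k =
   1. *)
have rec : OC n.+2 C (q + C ord_max) =
  (last_count n.+1 (compl C) * OC n.+1 C (q + C ord_max)
    + last_count n.+1 C * (if q is q'.+1 then OC n.+1 C (q' + C ord_max) else 0))%N.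
  rewrite OC_recr; case: q {qn} => [|q] //; rewrite add0n.
  by case E: (C ord_max) => //=; rewrite (@OC_eq0_small _ _ _ 0%N) ?E.
rewrite rec {rec} natrD !natrM !last_countR // -/F -/F'.
rewrite /maxterm HnXS // -/H -/F -/(P _) /= factS natrM exprMn.
case: q qn => [_|q qn].
  rewrite mulr0 addr0 expr0 fact0 divr1 mulr1 subn0.
  have := IH 0%N isT; rewrite /maxterm expr0 fact0 divr1 mulr1 subn0 -/(P _) /=.
  move=> h; apply: (@le_trans _ _ (n.+1%:R ^+ k * F' * ((n`!)%:R ^+ k * P n.+1))).
    by apply: ler_wpM2l h; rewrite mulr_ge0 ?exprn_ge0.
  rewrite [leLHS](_ : _ = (n.+1%:R ^+ k * (n`!)%:R ^+ k) * (F' * P n.+1)); last by ring.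
  by apply: ler_wpM2l => //; apply: PF; rewrite leqnn.
have fq : (q.+1`!%:R : R) != 0 by rewrite pnatr_eq0 -lt0n fact_gt0.
have h1 := IH q qn.
have h2 : (OC n.+1 C (q.+1 + C ord_max))%:R * F' <=
   (n`!)%:R ^+ k / (q.+1`!)%:R * H ^+ q.+1 * P (n.+1 - q)%N.
  have K0 : 0 <= (n`!)%:R ^+ k / (q.+1`!)%:R * H ^+ q.+1.
    by rewrite !mulr_ge0 ?exprn_ge0 // invr_ge0.
  (* At the top index q + 1 = n + 1 the induction hypothesis does not apply, but the count is
     zero. *)
  move: qn; rewrite leq_eqVlt => /orP[/eqP E|qn].
    by rewrite OC_eq0_large -?E // mul0r mulr_ge0.
  apply: le_trans (ler_wpM2r F'0 (IH q.+1 qn)) _.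
  rewrite /maxterm -[leLHS]mulrA -/(P _) -/H /=; apply: ler_wpM2l => //.
  have -> : (n.+1 - q = (n.+1 - q.+1).+1)%N by lia.
  by rewrite mulrC; apply: PF; lia.
rewrite subSS; set p := P (n.+1 - q)%N in h2 *.
have K0 : 0 <= n.+1%:R ^+ k * (n`!)%:R ^+ k / (q.+1`!)%:R * p.
  by rewrite !mulr_ge0 ?exprn_ge0 ?invr_ge0 // P0.
(* Both summands are bounded with a common factor; what remains is the first-order bound on (H +
   F)^(q+1). *)
apply: le_trans (_ : n.+1%:R ^+ k * (n`!)%:R ^+ k / (q.+1`!)%:R * p *
  (H ^+ q.+1 + q.+1%:R * F * H ^+ q) <= _); last first.
  rewrite [leRHS](_ : _ = n.+1%:R ^+ k * (n`!)%:R ^+ k / (q.+1`!)%:R * p *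
    (H + F) ^+ q.+1); last by ring.
  by apply: ler_wpM2l => //; apply: first_order_le_exprD.
rewrite mulrDr; apply: lerD.
  rewrite -!mulrA [F' * _]mulrC; apply: le_trans (ler_wpM2l _ h2) _.
    by rewrite exprn_ge0.
  by rewrite le_eqVlt; apply/orP; left; apply/eqP; ring.
apply: le_trans (ler_wpM2l _ h1) _; first by rewrite mulr_ge0 ?exprn_ge0.
rewrite /maxterm -/H -/(P _) -/p /= factS natrM le_eqVlt; apply/orP; left; apply/eqP.
have fq' : (q`!%:R : R) != 0 by rewrite pnatr_eq0 -lt0n fact_gt0.
by field; rewrite fq' /= ?(natr1, nat1r) ?pnatr_eq0.
Qed.

Lemma OC_le_OCmax (R : realType) (k n : nat) (C : 'I_k.+1 -> bool) (m : nat) :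
  (0 < n)%N -> (OC n C m)%:R <= OCmax R n C m.
Proof.
move=> n0; case: (ltnP m (C ord_max)) => [mc|cm].
  by rewrite OC_eq0_small // OCmax_ge0.
case: (leqP (n + C ord_max) m) => [nm|mn].
  by rewrite OC_eq0_large // OCmax_ge0.
have mE : m = (m - C ord_max + C ord_max)%N by rewrite subnK.
by rewrite mE OCmaxE ?OC_le_maxterm // ltn_subLR // addnC.
Qed.

(** The closed form occupies the arguments 1..n when c_k = 1 and 0..n-1 when c_k = 0; the one
    remaining argument contributes 0. *)
Lemma sum_OCmax (R : realType) (k n : nat) (C : 'I_k.+1 -> bool) :
  \sum_(0 <= m < n.+1) OCmax R n C m = \sum_(0 <= q < n) maxterm R n C q.
Proof.
case cmax: (C ord_max).
  rewrite big_nat_recl // {1}/OCmax cmax /= add0r; apply: eq_big_nat => q /= qn.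
  by rewrite -OCmaxE // cmax addn1.
rewrite big_nat_recr //= {2}/OCmax cmax subn0 /= ltnn addr0.
by apply: eq_big_nat => q /= qn; rewrite -OCmaxE // cmax addn0.
Qed.

(** Dropping the complementary part gives F_(i+1) <= ((i+1)/i)^k, and these bounds telescope. *)
Lemma prod_Fj_le (R : realType) (k r : nat) (C : 'I_k.+1 -> bool) :
  (0 < r)%N -> \prod_(1 <= i < r) Fj i.+1 (vecR R C) <= r%:R ^+ k.
Proof.
case: r => // r _; elim: r => [|r IH]; first by rewrite big_geq // expr1n.
rewrite big_nat_recr //=.
have -> : r.+2%:R ^+ k = r.+1%:R ^+ k * (r.+2%:R / r.+1%:R) ^+ k :> R.
  by rewrite -exprMn mulrC divfK // pnatr_eq0.
apply: ler_pM => //; first by apply: prodr_ge0 => i _; exact: Fj_ge0.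
  exact: Fj_ge0.
by rewrite -(Fj_add_compl R C) // lerDl Fj_ge0.
Qed.

Lemma sum_stirling1u (n : nat) :
  (\sum_(0 <= m < n.+1) stirling1u n m = n`!)%N.
Proof.
have s0 n' m : (n' < m)%N -> stirling1u n' m = 0%N.
  by elim: n' m => [|n' IH] [|m] //= nm; rewrite !IH ?muln0 //; lia.
elim: n => [|n IH]; first by rewrite big_nat1.
rewrite big_nat_recl //= add0n big_split /= IH -big_distrr /=.
(* For n > 0 the shift changes nothing, as the terms at m = 0 and m = n + 1 are zero; for n = 0 the
   factor n is zero. *)
have -> : (n * \sum_(0 <= i < n.+1) stirling1u n i.+1 = n * n`!)%N.
  case: n IH => [|n] IH; first by rewrite !mul0n.
  rewrite -IH; congr muln; rewrite big_nat_recr // [in RHS]big_nat_recl //.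
  by rewrite (s0 n.+1 n.+2) //= addn0 add0n.
by rewrite factS mulSn addnC.
Qed.

(** * Elementary inequalities *)

Lemma derive_ge0_le (R : realType) (f df : R -> R) (a b : R) : a <= b ->
  (forall x, a <= x <= b -> is_derive x 1 f (df x)) ->
  (forall x, a <= x <= b -> 0 <= df x) -> f a <= f b.
Proof.
rewrite le_eqVlt => /orP[/eqP->//|ab] fdf df0.
have in_ab x : x \in `]a, b[ -> a <= x <= b.
  by rewrite in_itv /= => /andP[/ltW-> /ltW->].
have [c cab] : exists2 c, c \in `]a, b[ & f b - f a = df c * (b - a).
  apply: MVT => // [x /in_ab|]; first exact: fdf.
  apply: derivable_within_continuous => x; rewrite in_itv /= => xab.
  by apply: ex_derive; exact: fdf.
move=> E; rewrite -subr_ge0 E mulr_ge0 ?subr_ge0 ?(ltW ab) //.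
by apply: df0; exact: in_ab.
Qed.

Lemma sin_le (R : realType) (x : R) : 0 <= x -> sin x <= x.
Proof.
move=> x0; rewrite -subr_ge0.
have := @derive_ge0_le R (fun x => x - sin x) (fun x => 1 - cos x) 0 x x0.
rewrite sin0 subr0; apply => y _; by rewrite subr_ge0 cos_le1.
Qed.

Lemma ler_sinh (R : realType) (s : R) : 0 <= s -> s *+ 2 <= expR s - expR (- s).
Proof.
move=> s0; rewrite -subr_ge0.
have := @derive_ge0_le R (fun x => expR x - (expR \o -%R) x - x *+ 2)
  (fun x => expR x + expR (- x) - 1 *+ 2) 0 s s0.
rewrite /= oppr0 mul0rn subrr subr0; apply => x _.
  apply: is_derive_eq.
  ring.
(* The derivative times e^x is (e^x - 1)^2. *)
have := sqr_ge0 (expR x - 1); have := expR_gt0 x.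
rewrite expRN => e0 sq; rewrite -(pmulr_lge0 _ e0) !mulrDl mulVf ?gt_eqF //.
by apply: le_trans sq _; rewrite le_eqVlt; apply/orP; left; apply/eqP; ring.
Qed.

(** This is [ler_sinh] at s = log y. At y = (N+1)/N it says that the trapezoid rule overestimates
    the integral of 1/x over [N, N+1]. *)
Lemma ln_trapezoid (R : realType) (y : R) : 1 <= y -> ln y *+ 2 <= y - y^-1.
Proof.
move=> y1; have y0 : 0 < y by apply: lt_le_trans y1.
by have := ler_sinh (ln_ge0 y1); rewrite expRN !lnK // posrE.
Qed.

(** The left side truncates the series of 2 artanh t; the difference has derivative 2 x^8 / (1 -
    x^2). *)
Lemma ln_atanh_ge (R : realType) (t : R) : 0 <= t < 1 ->
  2 * (t + t ^+ 3 / 3 + t ^+ 5 / 5 + t ^+ 7 / 7) <= ln ((1 + t) / (1 - t)).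
Proof.
move=> /andP[t0 t1]; rewrite ln_div ?posrE; [|lra|lra].
pose p : {poly R} := 2 *: ('X + 3^-1 *: 'X^3 + 5^-1 *: 'X^5 + 7^-1 *: 'X^7).
have pE x : p.[x] = 2 * (x + x ^+ 3 / 3 + x ^+ 5 / 5 + x ^+ 7 / 7).
  by rewrite /p !(hornerZ, hornerD, hornerX, hornerXn); lra.
have dpE x : p^`().[x] = 2 * (1 + x ^+ 2 + x ^+ 4 + x ^+ 6).
  rewrite /p !(derivZ, derivD, derivX, derivXn).
  by rewrite !(hornerZ, hornerD, hornerMn, hornerC, hornerXn) /=; lra.
have p0 : p.[0] = 0 by rewrite pE !expr0n /=; lra.
rewrite -pE -subr_ge0.
have := @derive_ge0_le R (fun x => (@ln R \o (fun x => 1 + x)) x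
    - (@ln R \o (fun x => 1 - x)) x - p.[x])
  (fun x => (1 + x)^-1 + (1 - x)^-1 - p^`().[x]) 0 t t0.
rewrite /= addr0 subr0 subrr p0 subr0; apply => x /andP[x0 xt].
  have d1 : is_derive x 1 (@ln R \o (fun x => 1 + x)) (1 + x)^-1.
    have h : 0 < 1 + x by lra.
    have d0 : is_derive x 1 (fun x : R => 1 + x) 1.
      have := is_deriveD (is_derive_cst (1 : R^o) x 1) (is_derive_id (x : R^o) 1).
      by rewrite add0r.
    have dl : is_derive ((fun x : R => 1 + x) x) 1 (@ln R) (1 + x)^-1.
      exact: is_derive1_ln.
    by apply: (is_derive_eq (is_derive1_comp dl d0)); rewrite mulr1.
  have d2 : is_derive x 1 (@ln R \o (fun x => 1 - x)) (- (1 - x)^-1).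
    have h : 0 < 1 - x by lra.
    have d0 : is_derive x 1 (fun x : R => 1 - x) (- 1).
      have := is_deriveB (is_derive_cst (1 : R^o) x 1) (is_derive_id (x : R^o) 1).
      by rewrite sub0r.
    have dl : is_derive ((fun x : R => 1 - x) x) 1 (@ln R) (1 - x)^-1.
      exact: is_derive1_ln.
    have := @is_derive1_comp R (@ln R) (fun x : R => 1 - x) x _ _ dl d0.
    by rewrite mulrN1.
  apply: (is_derive_eq (is_deriveB (is_deriveB d1 d2) (is_derive_poly p x))).
  by rewrite opprK.
rewrite dpE subr_ge0.
have -> : (1 + x)^-1 + (1 - x)^-1 = 2 / (1 - x ^+ 2).
  by field; apply/and3P; split; apply/eqP; nra.
have x21 : x ^+ 2 < 1 by nra.
rewrite ler_pdivlMr ?subr_gt0 // -subr_ge0.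
have := exprn_ge0 8 x0 => h.
by rewrite (_ : _ - _ = 2 * x ^+ 8); [lra|ring].
Qed.

(** * Euler's constant *)

(* [harmonic_gap R 0 = 0] since [ln 0 = 0]; the monotonicity lemmas start at [1]. *)
Definition harmonic_gap (R : realType) (N : nat) : R :=
  \sum_(1 <= j < N.+1) (j%:R : R)^-1 - ln (N%:R : R).

Lemma harmonic_gapS (R : realType) (N : nat) : (0 < N)%N ->
  harmonic_gap R N.+1 =
  harmonic_gap R N + (N.+1%:R)^-1 - ln (N.+1%:R / N%:R).
Proof.
move=> N0; rewrite /harmonic_gap big_nat_recr //= ln_div ?posrE ?ltr0n //.
ring.
Qed.

Lemma harmonic_gap_nonincr (R : realType) (N : nat) : (0 < N)%N ->
  harmonic_gap R N.+1 <= harmonic_gap R N.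
Proof.
move=> N0; rewrite harmonic_gapS // -addrA gerDl subr_le0.
have Np : (0 : R) < N%:R by rewrite ltr0n.
have := @le_ln1Dx R (- (N.+1%:R)^-1).
have -> : 1 + - (N.+1%:R)^-1 = (N.+1%:R / N%:R)^-1 :> R.
  by rewrite -natr1; field; apply/andP; split; apply/eqP; lra.
rewrite lnV ?posrE ?divr_gt0 // lerN2; apply.
by rewrite ltrN2 invf_lt1 ?ltr0n // ltr1n.
Qed.

Lemma harmonic_gap_lower_step (R : realType) (N : nat) : (0 < N)%N ->
  harmonic_gap R N - (2 * N%:R)^-1 <= harmonic_gap R N.+1 - (2 * N.+1%:R)^-1.
Proof.
move=> N0; rewrite harmonic_gapS //; set g := harmonic_gap R N.
have Np : (0 : R) < N%:R by rewrite ltr0n.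
have := @ln_trapezoid R (N.+1%:R / N%:R).
rewrite ler_pdivlMr // mul1r ler_nat leqnSn => /(_ isT).
set l := ln _; rewrite -natr1; set x : R := N%:R in Np *.
have -> : (x + 1) / x - ((x + 1) / x)^-1 =
    2 * (x + 1)^-1 - 2 * (2 * (x + 1))^-1 + 2 * (2 * x)^-1.
  by field; do ?[apply/andP; split]; apply/eqP; lra.
by rewrite mulr2n; lra.
Qed.

(** Adding the next Euler-Maclaurin correction makes the sequence decrease. Two terms of the artanh
    series at t = 1/(2N+1), where (1+t)/(1-t) = (N+1)/N, are enough. *)
Lemma harmonic_gap_upper_step (R : realType) (N : nat) : (0 < N)%N ->
  harmonic_gap R N.+1 - (2 * N.+1%:R)^-1 + (12 * N.+1%:R ^+ 2)^-1
  <= harmonic_gap R N - (2 * N%:R)^-1 + (12 * N%:R ^+ 2)^-1.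
Proof.
move=> N0; rewrite harmonic_gapS //; set g := harmonic_gap R N.
have Np : (0 : R) < N%:R by rewrite ltr0n.
rewrite -natr1; set x : R := N%:R in Np *.
pose t := (2 * x + 1)^-1.
have t0 : 0 < t by rewrite invr_gt0; lra.
have t1 : t < 1 by rewrite invf_lt1; lra.
have /ln_atanh_ge : 0 <= t < 1 by rewrite (ltW t0).
have -> : (1 + t) / (1 - t) = (x + 1) / x.
  by rewrite /t; field; do ?[apply/andP; split]; apply/eqP; lra.
set l := ln _ => h.
have h5 := exprn_ge0 5 (ltW t0); have h7 := exprn_ge0 7 (ltW t0).
have h' : 2 * t + 2 / 3 * t ^+ 3 <= l by lra.
suff : (x + 1)^-1 - (2 * (x + 1))^-1 + (12 * (x + 1) ^+ 2)^-1
    + (2 * x)^-1 - (12 * x ^+ 2)^-1 <= 2 * t + 2 / 3 * t ^+ 3 by lra.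
rewrite -subr_ge0.
have -> : 2 * t + 2 / 3 * t ^+ 3 - ((x + 1)^-1 - (2 * (x + 1))^-1
   + (12 * (x + 1) ^+ 2)^-1 + (2 * x)^-1 - (12 * x ^+ 2)^-1)
   = (2 * x ^+ 2 + 2 * x + 1) / (12 * x ^+ 2 * (x + 1) ^+ 2 * (2 * x + 1) ^+ 3).
  rewrite /t; field; do ?[apply/andP; split]; apply/eqP; lra.
by apply: divr_ge0; [nra|rewrite !mulr_ge0 ?exprn_ge0 //; lra].
Qed.

Lemma harmonic_gap_lower (R : realType) (N M : nat) : (0 < N <= M)%N ->
  harmonic_gap R N - (2 * N%:R)^-1 <= harmonic_gap R M - (2 * M%:R)^-1.
Proof.
move=> /andP[N0]; elim: M => [|M IH]; first by case: N N0.
rewrite leq_eqVlt ltnS => /orP[/eqP->//|NM].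
apply: le_trans (IH NM) (harmonic_gap_lower_step _ _).
exact: leq_trans N0 NM.
Qed.

Lemma harmonic_gap_upper (R : realType) (N M : nat) : (0 < N <= M)%N ->
  harmonic_gap R M - (2 * M%:R)^-1 + (12 * M%:R ^+ 2)^-1
  <= harmonic_gap R N - (2 * N%:R)^-1 + (12 * N%:R ^+ 2)^-1.
Proof.
move=> /andP[N0]; elim: M => [|M IH]; first by case: N N0.
rewrite leq_eqVlt ltnS => /orP[/eqP->//|NM].
apply: le_trans (harmonic_gap_upper_step _ _) (IH NM).
exact: leq_trans N0 NM.
Qed.

Lemma harmonic_gap_cvg (R : realType) : cvgn (harmonic_gap R).
Proof.
(* Index 0 is skipped: the gap is 0 there but 1 at index 1, which would break monotonicity. *)
suff : cvgn (fun n => harmonic_gap R n.+1).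
  by move=> /cvg_ex[l ul]; apply/cvg_ex; exists l; rewrite -cvg_shiftS.
apply: nonincreasing_is_cvgn.
  by apply/nonincreasing_seqP => n; exact: harmonic_gap_nonincr.
exists (harmonic_gap R 1 - (2 * 1%:R)^-1) => _ [n _ <-].
apply: le_trans (harmonic_gap_lower R (_ : 0 < 1 <= n.+1)%N) _ => //.
by rewrite gerBl invr_ge0 mulr_ge0.
Qed.

Lemma euler_gamma_ge (R : realType) (N : nat) : (0 < N)%N ->
  harmonic_gap R N - (2 * N%:R)^-1 <= euler_gamma R.
Proof.
move=> N0; rewrite -[leRHS]/(limn (harmonic_gap R)).
apply: limr_ge; first exact: harmonic_gap_cvg.
exists N => // M /= NM; apply: le_trans (harmonic_gap_lower R (_ : 0 < N <= M)%N) _.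
  by rewrite N0.
by rewrite gerBl invr_ge0 mulr_ge0.
Qed.

Lemma euler_gamma_le (R : realType) (N : nat) : (0 < N)%N ->
  euler_gamma R <= harmonic_gap R N - (2 * N%:R)^-1 + (12 * N%:R ^+ 2)^-1.
Proof.
move=> N0; apply/ler_addgt0Pr => e e0.
rewrite -[leLHS]/(limn (harmonic_gap R)).
apply: limr_le; first exact: harmonic_gap_cvg.
(* From index K on, the correction 1/(2M) is at most e. *)
pose K := Num.Def.archi_bound (e^-1).
have eK : e^-1 < K%:R by apply: archi_boundP; rewrite invr_ge0 ltW.
exists (N + K)%N => // M /= NM.
have M0 : (0 < M)%N by lia.
have Mp : (0 : R) < M%:R by rewrite ltr0n.
have := harmonic_gap_upper R (_ : 0 < N <= M)%N.
rewrite N0 => /(_ (leq_trans (leq_addr _ _) NM)).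
have : (0 : R) <= (12 * M%:R ^+ 2)^-1 by rewrite invr_ge0 mulr_ge0 ?exprn_ge0.
suff : (2 * M%:R)^-1 <= e by lra.
have : (2 * M%:R)^-1 <= (M%:R : R)^-1.
  by rewrite lef_pV2 ?posrE ?mulr_gt0 //; lra.
move=> /le_trans; apply.
rewrite -[e]invrK lef_pV2 ?posrE ?invr_gt0 //.
by apply: le_trans (ltW eK) _; rewrite ler_nat; lia.
Qed.

Lemma euler_gamma_ge_half (R : realType) : 2^-1 <= euler_gamma R.
Proof.
apply: le_trans (euler_gamma_ge R (isT : 0 < 1)%N).
by rewrite /harmonic_gap big_nat1 ln1; lra.
Qed.

(** Monotonicity of the gap gives log((N+1)/N) >= 1/(N+1) >= 1/(2N), which is the correction in
    [euler_gamma_ge]. *)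
Lemma harmonic_gap_ln_succ_le (R : realType) (N : nat) : (0 < N)%N ->
  \sum_(1 <= j < N.+1) (j%:R : R)^-1 - ln (N.+1%:R) <= euler_gamma R.
Proof.
move=> N0; apply: le_trans (euler_gamma_ge R N0).
have := harmonic_gap_nonincr R N0; rewrite {1}/harmonic_gap big_nat_recr //=.
set y := (2 * N%:R)^-1; set z := (N.+1%:R)^-1; set l := ln _.
suff : y <= z by lra.
by rewrite lef_pV2 ?posrE ?mulr_gt0 ?ltr0n // -natrM ler_nat; lia.
Qed.

Lemma harmonic_le (R : realType) (N : nat) : (0 < N)%N ->
  \sum_(1 <= j < N.+1) (j%:R : R)^-1
  <= (N.+1%:R / N%:R) * (ln N%:R + euler_gamma R).
Proof.
move=> N0; have := euler_gamma_ge R N0; have := euler_gamma_ge_half R.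
rewrite /harmonic_gap; set h := \sum_(_ <= _ < _) _; set g := euler_gamma R.
have Np : (0 : R) < N%:R by rewrite ltr0n.
have l0 : (0 : R) <= ln N%:R by apply: ln_ge0; rewrite ler1n.
rewrite -(natr1 N) invfM mulrDl divff ?gt_eqF // mulrDl mul1r.
set l := ln _ in l0 *; set y := (N%:R)^-1 => g2 hg.
have y0 : 0 <= y by rewrite invr_ge0 ltW.
(* The correction 1/(2N) is paid for by gamma >= 1/2. *)
rewrite mul1r; have : y * 2^-1 <= y * (l + g) by apply: ler_wpM2l => //; lra.
lra.
Qed.

Lemma expR_euler_gamma_le (R : realType) :
  expR (euler_gamma R) <= 17811%:R / 10000%:R.
Proof.
(* 8 * 1.7811 is just above (3/2)^6 * 339/271, and 3/2 and 339/271 are the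
   values of (1+t)/(1-t) at t = 1/5 and t = 34/305. *)
have cE : (3 / 2) ^+ 6 * (339%:R / 271%:R) / 8%:R <= 17811%:R / 10000%:R :> R by lra.
move: (17811%:R / 10000%:R : R) cE => c cE.
have p3 : (0 : R) < 3 / 2 by lra.
have p9 : (0 : R) < 339%:R / 271%:R by lra.
have p8 : (0 : R) < 8%:R by lra.
have p39 := mulr_gt0 (exprn_gt0 6 p3) p9; have pq := divr_gt0 p39 p8.
apply: le_trans cE; rewrite -[leRHS]lnK ?posrE // ler_expR.
(* At N = 8 the estimate exceeds gamma by only about 2/10^6, and log 8 occurs on both sides and
   cancels. *)
apply: le_trans (euler_gamma_le R (isT : 0 < 8)%N) _.
rewrite /harmonic_gap /index_iota /= !big_cons big_nil.
have h3 := @ln_atanh_ge R (5^-1); have h9 := @ln_atanh_ge R (34%:R / 305%:R).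
have e3 : (1 + 5^-1) / (1 - 5^-1) = 3 / 2 :> R.
  by apply: (canLR (mulfK _)); [apply: lt0r_neq0; lra | lra].
have e9 : (1 + 34%:R / 305%:R) / (1 - 34%:R / 305%:R) = 339%:R / 271%:R :> R.
  by apply: (canLR (mulfK _)); [apply: lt0r_neq0; lra | lra].
rewrite {}e3 in h3; rewrite {}e9 in h9.
have {}h3 := h3 ltac:(apply/andP; split; lra).
have {}h9 := h9 ltac:(apply/andP; split; lra).
rewrite ln_div ?posrE // lnM ?posrE ?(exprn_gt0 6 p3) // lnXn //.
set l8 := ln 8%:R; set l3 := ln _ in h3 *; set l9 := ln _ in h9 *.
lra.
Qed.

(** * Partial sums of zeta(2) *)

Lemma big_nat_double (R : realType) (F : nat -> R) (n : nat) :
  \sum_(0 <= k < n.*2) F k = \sum_(0 <= k < n) (F k.*2 + F k.*2.+1).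
Proof.
elim: n => [|n IH]; first by rewrite !big_geq.
by rewrite doubleS !big_nat_recr //= IH addrA.
Qed.

(** The second sine is cos (x/2), so this combines sin x = 2 sin (x/2) cos (x/2) with the
    Pythagorean identity. *)
Lemma csc2_half (R : realType) (x : R) : 0 < x < pi ->
  (sin x ^+ 2)^-1 =
  ((sin (x / 2) ^+ 2)^-1 + (sin ((x + pi) / 2) ^+ 2)^-1) / 4.
Proof.
move=> /andP[x0 xpi].
have s0 : 0 < sin (x / 2) by apply: sin_gt0_pi; lra.
have c0 : 0 < cos (x / 2) by apply: cos_gt0_pihalf; lra.
have -> : (x + pi) / 2 = x / 2 + pi / 2 by lra.
have -> : sin x = (cos (x / 2) * sin (x / 2)) *+ 2.
  by rewrite -sin_mulr2n; congr sin; lra.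
rewrite sinDpihalf; have := cos2Dsin2 (x / 2).
set s := sin _ in s0 *; set c := cos _ in c0 * => sc.
have -> : (s ^+ 2)^-1 + (c ^+ 2)^-1 = (c ^+ 2 + s ^+ 2) / (s ^+ 2 * c ^+ 2).
  by field; rewrite !gt_eqF.
by rewrite sc; field; rewrite !gt_eqF.
Qed.

(** The terms m = k and m = -(k+1) of the expansion of csc^2 x as the sum of 1/(x + m pi)^2 over all
    integers m. *)
Definition csc2_term (R : realType) (x : R) (k : nat) : R :=
  ((x + k%:R * pi) ^+ 2)^-1 + ((k.+1%:R * pi - x) ^+ 2)^-1.

(** Mirrors [csc2_half] on the expansion: even multiples of pi come from x/2, odd ones from (x +
    pi)/2. *)
Lemma csc2_term_double (R : realType) (x : R) (k : nat) : 0 < x < pi ->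
  csc2_term x k.*2 + csc2_term x k.*2.+1 =
  (csc2_term (x / 2) k + csc2_term ((x + pi) / 2) k) / 4.
Proof.
move=> /andP[x0 xpi]; rewrite /csc2_term.
rewrite -(natr1 k.*2.+1) -(natr1 k.*2) -(natr1 k) -muln2 natrM.
have k0 : (0 : R) <= k%:R by [].
have p0 : 0 <= k%:R * pi :> R by rewrite mulr_ge0 ?pi_ge0.
set p : R := pi in xpi p0 *; set y : R := k%:R in k0 p0 *.
have a1 : x + y * 2 * p != 0 by rewrite gt_eqF //; lra.
have a2 : (y * 2 + 1) * p - x != 0 by rewrite gt_eqF //; lra.
have a3 : x + (y * 2 + 1) * p != 0 by rewrite gt_eqF //; lra.
have a4 : (y * 2 + 1 + 1) * p - x != 0 by rewrite gt_eqF //; lra.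
have -> : x / 2 + y * p = (x + y * 2 * p) / 2 by lra.
have -> : (y + 1) * p - x / 2 = ((y * 2 + 1 + 1) * p - x) / 2 by lra.
have -> : (x + p) / 2 + y * p = (x + (y * 2 + 1) * p) / 2 by lra.
have -> : (y + 1) * p - (x + p) / 2 = ((y * 2 + 1) * p - x) / 2 by lra.
move: a1 a2 a3 a4; set u1 := x + _; set u2 := _ - x; set u3 := x + _; set u4 := _ - x.
by move=> a1 a2 a3 a4; field; rewrite a1 a2 a3 a4.
Qed.

(* The halving identity for csc^2 sends the defect [1] at depth [0] to [1/2^a]
   at depth [a]. *)
Lemma csc2_lower (R : realType) (a : nat) (x : R) : 0 < x < pi ->
  \sum_(0 <= k < 2 ^ a) csc2_term x k <= (sin x ^+ 2)^-1 + (2 ^+ a)^-1.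
Proof.
elim: a x => [|a IH] x xpi.
  rewrite expn0 big_nat1 /csc2_term mul0r addr0 mul1r expr0 invr1.
  have s0 : 0 < sin x := sin_gt0_pi xpi.
  have sx (y : R) : 0 < y -> sin x <= y -> (y ^+ 2)^-1 <= (sin x ^+ 2)^-1.
    move=> y0 sy; rewrite lef_pV2 ?posrE ?exprn_gt0 //.
    by apply: lerXn2r => //; rewrite nnegrE ltW.
  have inv1 (y : R) : 1 <= y -> (y ^+ 2)^-1 <= 1.
    by move=> y1; rewrite invf_le1 ?exprn_ege1 // exprn_gt0 //; lra.
  have p2 := pi_ge2 R; move: xpi => /andP[x0 xpi].
  (* The smaller of x and pi - x is handled by sin y <= y; the larger is at least pi/2 >= 1 and
     accounts for the defect 1. *)
  case: (leP x (pi / 2)) => xp.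
    apply: lerD; first by apply: sx => //; apply: sin_le; exact: ltW.
    by apply: inv1; lra.
  rewrite addrC; apply: lerD; last by apply: inv1; lra.
  apply: sx; first by lra.
  have -> : sin x = sin (pi - x) by rewrite sinB sinpi cospi; lra.
  by apply: sin_le; lra.
rewrite expnS mul2n big_nat_double.
rewrite (eq_bigr (fun k =>
  (csc2_term (x / 2) k + csc2_term ((x + pi) / 2) k) / 4)); last first.
  by move=> k _; exact: csc2_term_double.
rewrite -mulr_suml big_split /= (csc2_half xpi).
have -> : (2 ^+ a.+1)^-1 = (2 ^+ a)^-1 / 2 :> R by rewrite exprSr invfM mulrC.
move: xpi => /andP[x0 xpi].
have /IH h1 : 0 < x / 2 < pi by apply/andP; split; lra.
have /IH h2 : 0 < (x + pi) / 2 < pi by apply/andP; split; lra.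
by set e := (2 ^+ a)^-1 in h1 h2 *; lra.
Qed.

(** At x = pi/2 the k-th csc^2 term is 8 / ((2k+1) pi)^2 and csc^2 x = 1. The depth [a] is chosen to
    cover M terms and push the defect below e. *)
Lemma sum_odd_inv_sqr_le (R : realType) (M : nat) :
  \sum_(0 <= k < M) ((k.*2.+1)%:R ^+ 2)^-1 <= pi ^+ 2 / 8 :> R.
Proof.
have p2 := pi_ge2 R; have p0 : (0 : R) < pi by lra.
suff H : (\sum_(0 <= k < M) ((k.*2.+1)%:R ^+ 2)^-1) * (8 / pi ^+ 2) <= 1 :> R.
  have q0 : (0 : R) < 8 / pi ^+ 2 by rewrite divr_gt0 ?exprn_gt0.
  by move: H; rewrite -ler_pdivlMr // mul1r invf_div.
apply/ler_addgt0Pr => e e0.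
pose a := (M + Num.Def.archi_bound (e^-1))%N.
have aM : (M <= 2 ^ a)%N.
  by apply: leq_trans (ltnW (ltn_expl a (isT : 1 < 2)%N)); rewrite leq_addr.
have ea : (2 ^+ a)^-1 <= e.
  rewrite -[e]invrK lef_pV2 ?posrE ?invr_gt0 ?exprn_gt0 //.
  have /ltW/le_trans : e^-1 < (Num.Def.archi_bound (e^-1))%:R.
    by apply: archi_boundP; rewrite invr_ge0 ltW.
  apply; rewrite -natrX ler_nat.
  by apply: leq_trans (ltnW (ltn_expl a (isT : 1 < 2)%N)); rewrite leq_addl.
have pp : 0 < (pi : R) / 2 < pi by apply/andP; split; lra.
have := csc2_lower a pp.
rewrite sin_pihalf expr1n invr1 => h.
apply: le_trans (le_trans h _); last by lra.
rewrite mulr_suml [leRHS](big_cat_nat _ aM) //=.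
rewrite (eq_big_nat _ _ (F2 := csc2_term (pi / 2))); last first.
  move=> k _; rewrite /csc2_term -(natr1 k.*2) -(natr1 k) -muln2 natrM.
  have k0 : (0 : R) <= k%:R by [].
  set p : R := pi in p0 *; set y : R := k%:R in k0 *.
  have -> : p / 2 + y * p = (y * 2 + 1) * p / 2 by lra.
  have -> : (y + 1) * p - p / 2 = (y * 2 + 1) * p / 2 by lra.
  by field; rewrite !gt_eqF //; lra.
by rewrite lerDl sumr_ge0 // => k _; rewrite addr_ge0 // invr_ge0 sqr_ge0.
Qed.

(** Let S_M be the sum of the first M terms. Splitting by parity, S_2M <= pi^2/8 + S_M/4 <= pi^2/8 +
    S_2M/4, so S_2M <= pi^2/6. *)
Lemma sum_inv_sqr_le (R : realType) (N : nat) :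
  \sum_(1 <= j < N) (j%:R ^+ 2)^-1 <= pi ^+ 2 / 6 :> R.
Proof.
have mono n m : (n <= m)%N -> \sum_(0 <= j < n) (j.+1%:R ^+ 2)^-1
    <= \sum_(0 <= j < m) (j.+1%:R ^+ 2)^-1 :> R.
  by move=> nm; rewrite [leRHS](big_cat_nat _ nm) //= lerDl sumr_ge0 //.
rewrite big_add1; set M := N.-1.
have MM : (M <= M.*2)%N by rewrite -addnn leq_addr.
apply: le_trans (mono _ _ MM) _; have := mono _ _ MM.
have := sum_odd_inv_sqr_le R M.
rewrite big_nat_double big_split /=.
rewrite [X in _ + X](_ : _ = (\sum_(0 <= j < M) (j.+1%:R ^+ 2)^-1) / 4).
  set s1 := \sum_(_ <= _ < _) _; set s2 := \sum_(_ <= _ < _) _.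
  by lra.
rewrite mulr_suml; apply: eq_bigr => k _.
rewrite -doubleS -muln2 natrM; field.
by rewrite ?(natr1, nat1r) pnatr_eq0.
Qed.

(** * Ratios *)

Lemma sum_expR_le (R : realType) (n : nat) (x : R) : 0 <= x ->
  \sum_(0 <= q < n) x ^+ q / (q`!)%:R <= expR x.
Proof.
move=> x0; apply: (nondecreasing_cvgn_le _ (is_cvg_series_exp_coeff x) n).
apply: nondecreasing_series => q _ _; exact: exp_coeff_ge0.
Qed.

Lemma lambdaC_ge0 (R : realType) (k n : nat) (C : 'I_k.+1 -> bool) :
  (1 < n)%N -> 0 <= lambdaC R n C.
Proof.
move=> n1; have g := euler_gamma_ge_half R.
have l0 : (0 : R) <= ln (n.-1)%:R by apply: ln_ge0; rewrite ler1n; lia.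
rewrite /lambdaC !addr_ge0 ?mulr_ge0 ?invr_ge0 ?exprn_ge0 ?pi_ge0 //; first by lra.
by apply: sumr_ge0 => b _; rewrite mulr_ge0.
Qed.

(** Compared term by term in b: only b = 1, the harmonic sum, needs the factor n/(n-1). For b >= 2,
    j^-b <= j^-2 reduces to the zeta(2) bound. *)
Lemma HnX_le_lambdaC (R : realType) (k n : nat) (C : 'I_k.+1 -> bool) :
  (0 < k)%N -> (1 < n)%N ->
  HnX n (vecR R C) <= n%:R / (n.-1)%:R * lambdaC R n C.
Proof.
case: n => // N k0; rewrite ltnS => N0 /=.
have Np : (0 : R) < N%:R by rewrite ltr0n.
have r1 : 1 <= N.+1%:R / N%:R :> R by rewrite ler_pdivlMr // mul1r ler_nat.
have rW (x : R) : 0 <= x -> x <= N.+1%:R / N%:R * x by move=> x0; rewrite ler_peMl.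
rewrite /HnX /lambdaC /= [leRHS]mulrDr [X in _ <= X + _]mulrDr.
rewrite (eq_bigr (fun b : 'I_k.+1 => vecR R C (inord b) * 'C(k, b)%:R *
  \sum_(1 <= j < N.+1) (j%:R ^- b))); last by move=> b _; rewrite inord_val.
rewrite -(big_mkord xpredT (fun b => vecR R C (inord b) * 'C(k, b)%:R *
  \sum_(1 <= j < N.+1) (j%:R ^- b))).
rewrite big_ltn // big_ltn // addrA.
apply: lerD; first apply: lerD.
- rewrite bin0 mulr1 (eq_bigr (fun=> 1)); last by move=> j _; rewrite expr0 invr1.
  by rewrite sumr_const_nat subn1; apply: rW; rewrite mulr_ge0.
- rewrite bin1 (eq_bigr (fun j => (j%:R)^-1)); last by move=> j _; rewrite expr1.
  rewrite [leRHS]mulrCA; apply: ler_wpM2l; first by rewrite mulr_ge0.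
  exact: harmonic_le.
- apply: le_trans (rW _ _); last first.
    rewrite mulr_ge0 ?divr_ge0 ?exprn_ge0 ?pi_ge0 //.
    by apply: sumr_ge0 => b _; rewrite mulr_ge0.
  rewrite mulr_sumr; apply: ler_sum_nat => b /andP[b2 _].
  rewrite [leRHS]mulrC; apply: ler_wpM2l; first by rewrite mulr_ge0.
  apply: le_trans (sum_inv_sqr_le R N.+1); apply: ler_sum_nat => j /andP[j1 _].
  rewrite lef_pV2 ?posrE ?exprn_gt0 ?ltr0n //.
  by apply: ler_weXn2l => //; rewrite ler1n.
Qed.

Lemma ratio_exp_le (R : realType) (n q : nat) : (q < n)%N ->
  (n%:R / (n.-1)%:R) ^+ q * (n - q)%:R <= n%:R :> R.
Proof.
elim: q => [|q IH] qn; first by rewrite expr0 mul1r subn0.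
apply: le_trans (IH (ltnW qn)); rewrite exprSr -mulrA.
apply: ler_wpM2l; first by rewrite exprn_ge0 ?divr_ge0.
have np : (0 : R) < (n.-1)%:R by rewrite ltr0n; lia.
(* Here (n-1)(n-q) - n(n-q-1) = q >= 0. *)
rewrite mulrAC ler_pdivrMr // -!natrM ler_nat.
have -> : n = n.-1.+1 by lia.
by rewrite /=; nia.
Qed.

Lemma maxterm_le (R : realType) (k n q : nat) (C : 'I_k.+1 -> bool) :
  (0 < k)%N -> (1 < n)%N -> (q < n)%N ->
  maxterm R n C q <= (n`!)%:R ^+ k * (lambdaC R n C ^+ q / (q`!)%:R).
Proof.
move=> k0 n1 qn; rewrite /maxterm.
have L0 := @lambdaC_ge0 R k n C n1; set L := lambdaC R n C in L0 *.
have H0 := HnX_ge0 R n C; have HL := @HnX_le_lambdaC R k n C k0 n1.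
set H := HnX _ _ in H0 HL *; rewrite -/L in HL.
set r : R := n%:R / (n.-1)%:R in HL.
have r0 : 0 <= r by rewrite divr_ge0.
set P := \prod_(_ <= _ < _) _.
have P0 : 0 <= P by apply: prodr_ge0 => i _; exact: Fj_ge0.
have PL : P <= (n - q)%:R ^+ k by apply: prod_Fj_le; rewrite subn_gt0.
have HP : H ^+ q * P <= L ^+ q * n%:R ^+ k.
  apply: (@le_trans _ _ ((r * L) ^+ q * (n - q)%:R ^+ k)).
    apply: ler_pM => //; first exact: exprn_ge0.
    by apply: lerXn2r; rewrite ?nnegrE ?mulr_ge0.
  rewrite exprMn mulrAC [leRHS]mulrC; apply: ler_wpM2r; first exact: exprn_ge0.
  (* One of the k factors n - q absorbs (n/(n-1))^q; the others are bounded by n. *)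
  case: k k0 {C L L0 H H0 HL P P0 PL} => // k _; rewrite !exprS mulrA.
  apply: ler_pM; rewrite ?mulr_ge0 ?exprn_ge0 //; first exact: ratio_exp_le.
  by apply: lerXn2r; rewrite ?nnegrE // ler_nat leq_subr.
have -> : (n`!)%:R ^+ k * (L ^+ q / (q`!)%:R) =
  ((n.-1)`!)%:R ^+ k / (q`!)%:R * (L ^+ q * n%:R ^+ k) :> R.
  have -> : n = n.-1.+1 by lia.
  by rewrite /= factS natrM exprMn; ring.
by rewrite -mulrA; apply: ler_wpM2l => //; rewrite divr_ge0 ?exprn_ge0.
Qed.

(** The denominator is n!^k whatever D is, so (ii) and (iii) are both instances. *)
Lemma sum_OCmax_ratio_le (R : realType) (k n : nat) (C D : 'I_k.+1 -> bool) :
  (0 < k)%N -> (1 < n)%N ->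
  (\sum_(0 <= m < n.+1) OCmax R n C m) / (\sum_(0 <= m < n.+1) (OC n D m)%:R)
  <= expR (lambdaC R n C).
Proof.
move=> k0 n1; rewrite -natr_sum sum_OC natrX sum_OCmax.
rewrite ler_pdivrMr ?exprn_gt0 ?ltr0n ?fact_gt0 // mulrC.
apply: le_trans (ler_wpM2l _ (@sum_expR_le R n _ (lambdaC_ge0 R C n1))).
  by rewrite mulr_sumr; apply: ler_sum_nat => q /= qn; exact: maxterm_le.
exact: exprn_ge0.
Qed.

Lemma sum_sumax_ratio_le (R : realType) (n : nat) : (1 < n)%N ->
  (\sum_(0 <= m < n.+1) sumax R n m) / (\sum_(0 <= m < n.+1) (stirling1u n m)%:R)
  <= expR (\sum_(1 <= i < n) (i%:R : R)^-1) / n%:R.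
Proof.
move=> n1; rewrite -natr_sum sum_stirling1u; set h := \sum_(1 <= _ < _) _.
have h0 : 0 <= h by apply: sumr_ge0 => i _; rewrite invr_ge0.
have nE : n = n.-1.+1 by lia.
have fE : (n`!)%:R = n%:R * ((n.-1)`!)%:R :> R by rewrite {1}nE factS natrM -nE.
have fp : (0 : R) < ((n.-1)`!)%:R by rewrite ltr0n fact_gt0.
have np : (0 : R) < n%:R by rewrite ltr0n; lia.
rewrite fE ler_pdivrMr ?mulr_gt0 // mulrA divfK ?gt_eqF //.
rewrite big_nat_recl // {1}/sumax /= add0r mulrC.
apply: le_trans (ler_wpM2l (ltW fp) (sum_expR_le n h0)).
rewrite mulr_sumr; apply: ler_sum_nat => q /= qn; rewrite /sumax /= qn -/h.
by rewrite mulrA mulrAC.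
Qed.

Theorem theorem5p3 (R : realType) (k n : nat) (C : 'I_k.+1 -> bool) :
  (1 <= k)%N -> (2 <= n)%N ->
  (* (i) *)
  (forall m : nat, (m <= n)%N ->
     ((OC n C m)%:R : R) <= OCmax R n (compl C) (n - m)) /\
  (* (ii) *)
  ((\sum_(0 <= m < n.+1) OCmax R n C m)
     / (\sum_(0 <= m < n.+1) (OC n C m)%:R) <= expR (lambdaC R n C)) /\
  (* (iii) *)
  ((\sum_(0 <= m < n.+1) OCmax R n (compl C) m)
     / (\sum_(0 <= m < n.+1) (OC n C m)%:R) <= expR (lambdaC R n (compl C))) /\
  (* (iv) *)
  ((\sum_(0 <= m < n.+1) sumax R n m)
     / (\sum_(0 <= m < n.+1) (stirling1u n m)%:R)
   <= (n.-1)%:R / n%:R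
        * expR (\sum_(2 <= j < n.+1) ((j.-1)%:R : R)^-1 - ln ((n.-1)%:R : R))
   /\ (n.-1)%:R / n%:R
        * expR (\sum_(2 <= j < n.+1) ((j.-1)%:R : R)^-1 - ln ((n.-1)%:R : R))
      <= expR (euler_gamma R)
   /\ expR (euler_gamma R) <= 17811%:R / 10000%:R).
Proof.
move=> k1 n2.
have np : (0 : R) < n%:R by rewrite ltr0n; lia.
have Np : (0 : R) < (n.-1)%:R by rewrite ltr0n; lia.
have midE : (n.-1)%:R / n%:R
    * expR (\sum_(2 <= j < n.+1) ((j.-1)%:R : R)^-1 - ln ((n.-1)%:R : R))
    = expR (\sum_(1 <= i < n) (i%:R : R)^-1) / n%:R.
  rewrite big_add1 /= expRD expRN lnK ?posrE //.
  by field; rewrite !gt_eqF.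
split; first by move=> m mn; rewrite (OC_compl C mn) OC_le_OCmax //; lia.
split; first exact: sum_OCmax_ratio_le.
split; first exact: sum_OCmax_ratio_le.
rewrite midE; split; first exact: sum_sumax_ratio_le.
split; last exact: expR_euler_gamma_le.
(* With n written as exp(log n), the claim becomes h_(n-1) - log n <= gamma. *)
rewrite -[X in _ / X]lnK ?posrE // -expRN -expRD ler_expR.
have nE : n = n.-1.+1 by lia.
by rewrite nE; apply: harmonic_gap_ln_succ_le; lia.
Qed.
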